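(* Let $n\in\{6,7,8\}$, let $K$ be an algebraically closed field, and let $f\in\operatorname{rad}^2R(\mathbb{E}_n)$ be an admissible element. For every $k\in\{0,\dots,2n-3\}$ let $$\{a_k\}\cup\big\{a_{i(k,l,j,0)}\cdots a_{i(k,l,j,l-1)} \;\big|\; l\in\{2,\dots,m\},\ j\in\{0,\dots,i(k,l)-1\}\big\}$$ be a basis of $e_{s(a_k)}P(\mathbb{E}_n)e_{t(a_k)}$ consisting of $a_k$ and of paths from $s(a_k)$ to $t(a_k)$, where $i(k,l)\in\mathbb{N}$ is the number of chosen paths of length $l$ and $i(k,l,j,s)\in\{0,\dots,2n-3\}$. Suppose that $\varphi:P^f(\mathbb{E}_n)\to P(\mathbb{E}_n)$ is a $K$-algebra homomorphism with $\varphi(e_i)=e_i$ for all vertices $i$ and such that, for some coefficients $\alpha(k,l,j)\in K$, $$\varphi(a_k)=a_k+\sum_{l=2}^{m}\sum_{j=0}^{i(k,l)-1}\alpha(k,l,j)\,a_{i(k,l,j,0)}\cdots a_{i(k,l,j,l-1)}\qquad\text{for } k=0,\dots,2n-3.$$ Then $\varphi$ is invertible, and hence is a $K$-algebra isomorphism.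
   Context: Let $n \in \{6,7,8\}$ and let $K$ be an algebraically closed field. Paths in quivers are composed from left to right; $s(a)$ and $t(a)$ denote the source and target of an arrow $a$, and $e_i$ the trivial path at vertex $i$. The quiver $Q=Q_{\mathbb{E}_n}$ has vertices $0,1,\dots,n-1$ and arrows $a_0: 0\to 3$, $\bar a_0: 3\to 0$, and $a_i: i\to i+1$, $\bar a_i: i+1\to i$ for $i=1,\dots,n-2$. Write $a_{n+i-1}=\bar a_i$ for $i\in\{0,\dots,n-2\}$, so that the arrows are $a_0,\dots,a_{2n-3}$. The preprojective algebra $P(\mathbb{E}_n)$ is the quotient of the path algebra $KQ$ by the ideal generated by the relations $a_0\bar a_0=0$; $a_1\bar a_1=0$; $\bar a_1a_1+a_2\bar a_2=0$; $\bar a_0a_0+\bar a_2a_2+a_3\bar a_3=0$; $\bar a_ia_i+a_{i+1}\bar a_{i+1}=0$ for $i\in\{3,\dots,n-3\}$; $\bar a_{n-2}a_{n-2}=0$. It is finite-dimensional; its longest nonzero paths have length $m$, where $m=10,16,28$ for $n=6,7,8$ respectively. Let $R(\mathbb{E}_n)=K\langle x,y\rangle/(x^2,y^3,(x+y)^{n-3})$, a quotient of the free associative algebra on $x,y$; it is a finite-dimensional local algebra with radical generated by $x,y$. An element $f\in \operatorname{rad}^2R(\mathbb{E}_n)$ is called admissible if $(x+y+f(x,y))^{n-3}=0$ in $R(\mathbb{E}_n)$. For an admissible $f$ (represented by a noncommutative polynomial in $x,y$ all of whose monomials have degree at least $2$), the deformed preprojective algebra $P^f(\mathbb{E}_n)$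 is the bound quiver algebra of $Q$ with the relations $a_0\bar a_0=0$; $a_1\bar a_1=0$; $\bar a_1a_1+a_2\bar a_2=0$; $\bar a_0a_0+\bar a_2a_2+a_3\bar a_3+f(\bar a_0a_0,\bar a_2a_2)=0$; $\bar a_ia_i+a_{i+1}\bar a_{i+1}=0$ for $i\in\{3,\dots,n-3\}$; $\bar a_{n-2}a_{n-2}=0$. Being a bound quiver algebra, its arrow ideal is nilpotent: explicitly, $P^f(\mathbb{E}_n)$ is the quotient of $KQ$ by the ideal generated by these relations together with all paths of length $m+1$ (equivalently, the quotient of the completed path algebra by the closed ideal generated by the relations). *)

(* Defs.v *)
From HB Require Import structures.
From mathcomp Require Import all_boot all_algebra.
From mathcomp Require Import generic_quotient ring_quotient.
From mathcomp Require Import finmap.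
From mathcomp Require Import boolp.
From mathcomp.multinomials Require Import monalg.

Set Implicit Arguments.
Unset Strict Implicit.
Unset Printing Implicit Defensive.

Import GRing.Theory.

Local Open Scope ring_scope.
Local Open Scope quotient_scope.

Section TwoSidedIdeals.
Variable A : nzRingType.

(* Two-sided ideal generated by S; over a K-algebra it is automatically closed
   under scaling, since c *: x = (c *: 1) * x. *)
Inductive ideal_gen (S : A -> Prop) : A -> Prop :=
| ideal_gen_in x : S x -> ideal_gen S x
| ideal_gen0 : ideal_gen S 0
| ideal_genD x y : ideal_gen S x -> ideal_gen S y -> ideal_gen S (x + y)
| ideal_genMl a x : ideal_gen S x -> ideal_gen S (a * x)
| ideal_genMr x a : ideal_gen S x -> ideal_gen S (x * a).

Definition left_ideal (I : A -> Prop) : Prop :=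
  [/\ I 0, forall x y, I x -> I y -> I (x + y) & forall a x, I x -> I (a * x)].

Definition maximal_left_ideal (M : A -> Prop) : Prop :=
  [/\ left_ideal M, ~ M 1
    & forall I : A -> Prop, left_ideal I -> ~ I 1 ->
        (forall x, M x -> I x) -> forall x, I x -> M x].

Definition jacobson_radical (x : A) : Prop :=
  forall M, maximal_left_ideal M -> M x.

Definition jacobson_radical2 : A -> Prop :=
  ideal_gen (fun z => exists x y,
    [/\ jacobson_radical x, jacobson_radical y & z = x * y]).

Lemma ideal_gen_morph (B : nzRingType) (eps : {additive A -> B})
    (S : A -> Prop) :
  monoid_morphism eps -> (forall s, S s -> eps s = 0) -> ~ ideal_gen S 1.
Proof.
move=> [eps1 epsM] eps0 I1.
suff: forall x, ideal_gen S x -> eps x = 0.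
  by move=> /(_ _ I1) /eqP; rewrite eps1 oner_eq0.
move=> x; elim=> {x I1} [x /eps0 //||x y _ ex _ ey|a x _ ex|x a _ ex].
- exact: raddf0.
- by rewrite raddfD ex ey addr0.
- by rewrite epsM ex mulr0.
- by rewrite epsM ex mul0r.
Qed.

Definition ideal_pred (S : A -> Prop) : {pred A} := fun x => `[< ideal_gen S x >].

Lemma ideal_predP S x : reflect (ideal_gen S x) (x \in ideal_pred S).
Proof. exact: asboolP. Qed.

Lemma ideal_pred_zmod S : zmod_closed (ideal_pred S).
Proof.
split=> [|x y /ideal_predP Ix /ideal_predP Iy]; apply/ideal_predP.
  exact: ideal_gen0.
by apply: ideal_genD => //; rewrite -mulN1r; apply: ideal_genMl.
Qed.

HB.instance Definition _ S :=
  GRing.isZmodClosed.Build A (ideal_pred S) (ideal_pred_zmod S).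

End TwoSidedIdeals.

(* A / (S); the properness argument makes the quotient a nonzero algebra, as
   required by algType. *)
Definition quot_alg (K : comNzRingType) (A : algType K) (S : A -> Prop)
    of ~ ideal_gen S 1 : Type := Quotient.quot (ideal_pred S : zmodClosed A).

Section QuotientAlgebra.
Variables (K : comNzRingType) (A : algType K) (S : A -> Prop).
Hypothesis proper : ~ ideal_gen S 1.

Local Notation Q := (quot_alg proper).

HB.instance Definition _ := GRing.Zmodule.on Q.

Definition qproj (x : A) : Q :=
  \pi_(Quotient.quot (ideal_pred S : zmodClosed A)) x.

Lemma qproj_eq x y : (qproj x = qproj y) <-> ideal_gen S (x - y).
Proof.
split=> [/eqP|/ideal_predP Ixy].
  by rewrite /qproj -Quotient.idealrBE => /ideal_predP.
by apply/eqP; rewrite /qproj -Quotient.idealrBE.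
Qed.

Definition qrep (u : Q) : A :=
  repr (u : Quotient.quot (ideal_pred S : zmodClosed A)).

Lemma qrepK : cancel qrep qproj.
Proof. exact: reprK. Qed.

Lemma qproj_is_zmod_morphism : zmod_morphism qproj.
Proof. by move=> x y; rewrite /qproj !raddfB. Qed.

HB.instance Definition _ :=
  GRing.isZmodMorphism.Build A Q qproj qproj_is_zmod_morphism.

Definition qmul (u v : Q) : Q := qproj (qrep u * qrep v).
Definition qscale (c : K) (u : Q) : Q := qproj (c *: qrep u).

Lemma qprojM x y : qproj (x * y) = qmul (qproj x) (qproj y).
Proof.
have Ir z : ideal_gen S (z - qrep (qproj z)) by apply/qproj_eq; rewrite qrepK.
apply/qproj_eq; set x' := qrep _; set y' := qrep _.
have ->: x * y - x' * y' = (x - x') * y + x' * (y - y').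
  by rewrite mulrBl mulrBr addrA subrK.
by apply: ideal_genD; [apply: ideal_genMr | apply: ideal_genMl]; apply: Ir.
Qed.

Lemma qprojZ c x : qproj (c *: x) = qscale c (qproj x).
Proof.
apply/qproj_eq; rewrite -scalerBr -[x - _]mul1r scalerAl.
by apply: ideal_genMl; apply/qproj_eq; rewrite qrepK.
Qed.

Lemma qprojP (u : Q) : exists x, u = qproj x.
Proof. by exists (qrep u); rewrite qrepK. Qed.

Lemma qmulA : associative qmul.
Proof.
move=> u v w; have [x ->] := qprojP u; have [y ->] := qprojP v.
by have [z ->] := qprojP w; rewrite -!qprojM mulrA.
Qed.

Lemma qmul1 : left_id (qproj 1) qmul.
Proof. by move=> u; have [x ->] := qprojP u; rewrite -qprojM mul1r. Qed.

Lemma qmulr1 : right_id (qproj 1) qmul.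
Proof. by move=> u; have [x ->] := qprojP u; rewrite -qprojM mulr1. Qed.

Lemma qmulDl : left_distributive qmul +%R.
Proof.
move=> u v w; have [x ->] := qprojP u; have [y ->] := qprojP v.
by have [z ->] := qprojP w; rewrite -raddfD -!qprojM -raddfD mulrDl.
Qed.

Lemma qmulDr : right_distributive qmul +%R.
Proof.
move=> u v w; have [x ->] := qprojP u; have [y ->] := qprojP v.
by have [z ->] := qprojP w; rewrite -raddfD -!qprojM -raddfD mulrDr.
Qed.

Lemma qone_neq0 : qproj 1 != 0.
Proof.
apply/eqP => h; apply: proper; rewrite -[1]subr0.
by apply/qproj_eq; rewrite raddf0.
Qed.

HB.instance Definition _ := GRing.Zmodule_isNzRing.Build Q
  qmulA qmul1 qmulr1 qmulDl qmulDr qone_neq0.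

Lemma qscaleA a b u : qscale a (qscale b u) = qscale (a * b) u.
Proof. by have [x ->] := qprojP u; rewrite -!qprojZ scalerA. Qed.

Lemma qscale1 : left_id 1 qscale.
Proof. by move=> u; have [x ->] := qprojP u; rewrite -qprojZ scale1r. Qed.

Lemma qscaleDr : right_distributive qscale +%R.
Proof.
move=> c u v; have [x ->] := qprojP u; have [y ->] := qprojP v.
by rewrite -raddfD -!qprojZ -raddfD scalerDr.
Qed.

Lemma qscaleDl u : {morph qscale^~ u : a b / a + b}.
Proof.
by move=> a b; have [x ->] := qprojP u; rewrite -!qprojZ -raddfD scalerDl.
Qed.

HB.instance Definition _ := GRing.Zmodule_isLmodule.Build K Q
  qscaleA qscale1 qscaleDr qscaleDl.

Lemma qscaleAl (c : K) (u v : Q) : c *: (u * v) = (c *: u) * v.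
Proof.
have [x ->] := qprojP u; have [y ->] := qprojP v.
change (qscale c (qmul (qproj x) (qproj y))
  = qmul (qscale c (qproj x)) (qproj y)).
by rewrite -qprojM -!qprojZ -qprojM scalerAl.
Qed.

HB.instance Definition _ := GRing.Lmodule_isLalgebra.Build K Q qscaleAl.

Lemma qscaleAr (c : K) (u v : Q) : c *: (u * v) = u * (c *: v).
Proof.
have [x ->] := qprojP u; have [y ->] := qprojP v.
change (qscale c (qmul (qproj x) (qproj y))
  = qmul (qproj x) (qscale c (qproj y))).
by rewrite -qprojM -!qprojZ -qprojM scalerAr.
Qed.

HB.instance Definition _ := GRing.Lalgebra_isAlgebra.Build K Q qscaleAr.

Lemma qproj_is_monoid_morphism : monoid_morphism qproj.
Proof. by split=> // x y; rewrite qprojM. Qed.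

HB.instance Definition _ :=
  GRing.isMonoidMorphism.Build A Q qproj qproj_is_monoid_morphism.

Lemma qproj_is_scalable : scalable qproj.
Proof. by move=> c x; rewrite qprojZ. Qed.

HB.instance Definition _ :=
  GRing.isScalable.Build K A Q *:%R qproj qproj_is_scalable.

End QuotientAlgebra.

Record quiver := Quiver {
  vertex : finType;
  arrow : finType;
  src : arrow -> vertex;
  tgt : arrow -> vertex;
  vertex_gt0 : (0 < #|vertex|)%N
}.

Section Paths.
Variable Q : quiver.

(* The word w, read from left to right, is a path of Q starting at v. *)
Fixpoint is_walk (v : vertex Q) (w : seq (arrow Q)) : bool :=
  if w is a :: w' then (src a == v) && is_walk (tgt a) w' else true.

Definition walk_end (v : vertex Q) (w : seq (arrow Q)) : vertex Q :=
  last v (map (@tgt Q) w).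

(* The start vertex is recorded so that the trivial paths are distinct. *)
Record qpath := QPath {
  qpath_val : vertex Q * seq (arrow Q);
  _ : is_walk qpath_val.1 qpath_val.2
}.

HB.instance Definition _ := [isSub for qpath_val].
HB.instance Definition _ := [Choice of qpath by <:].

Definition pstart (p : qpath) : vertex Q := (val p).1.
Definition pword (p : qpath) : seq (arrow Q) := (val p).2.
Definition pend (p : qpath) : vertex Q := walk_end (pstart p) (pword p).
Definition plength (p : qpath) : nat := size (pword p).

Lemma is_walk_cat v w1 w2 :
  is_walk v (w1 ++ w2) = is_walk v w1 && is_walk (walk_end v w1) w2.
Proof. by elim: w1 v => //= a w1 IH v; rewrite IH andbA. Qed.

Lemma walk_end_cat v w1 w2 :
  walk_end v (w1 ++ w2) = walk_end (walk_end v w1) w2.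
Proof. by rewrite /walk_end map_cat last_cat. Qed.

Lemma is_walk_nil v : is_walk (v, [::] : seq (arrow Q)).1 [::].
Proof. by []. Qed.

Definition ptriv (v : vertex Q) : qpath := @QPath (v, [::]) (is_walk_nil v).

Lemma is_walk_arrow (a : arrow Q) : is_walk (src a, [:: a]).1 [:: a].
Proof. by rewrite /= eqxx. Qed.

Definition parrow (a : arrow Q) : qpath :=
  @QPath (src a, [:: a]) (is_walk_arrow a).

(* Paths compose from left to right: p, then q. *)
Definition pcat (p q : qpath) : option qpath :=
  if pend p == pstart q then insub (pstart p, pword p ++ pword q) else None.

Lemma pcatP p q :
  if pend p == pstart q then
    exists2 r, pcat p q = Some r & val r = (pstart p, pword p ++ pword q)
  else pcat p q = None.
Proof.
rewrite /pcat; case: eqP => // Epq; case: insubP => [r _ Er|].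
  by exists r.
rewrite /= is_walk_cat (valP p) /= -/(pend p) Epq.
by have -> := valP q.
Qed.

Lemma pcat1p v q : pcat (ptriv v) q = if v == pstart q then Some q else None.
Proof.
have := pcatP (ptriv v) q; rewrite -[pend (ptriv v)]/v.
case: eqP => // Ev [r -> Er]; congr Some; apply: val_inj.
by rewrite [LHS]Er -[pstart (ptriv v)]/v Ev /pstart /pword; case: (val q).
Qed.

Lemma pcatp1 v p : pcat p (ptriv v) = if pend p == v then Some p else None.
Proof.
have := pcatP p (ptriv v); rewrite [pstart (ptriv v)]/=.
case: eqP => // Ev [r -> Er]; congr Some; apply: val_inj.
by rewrite [LHS]Er cats0 /pstart /pword; case: (val p).
Qed.

Lemma pcatA p q r :
  obind (fun s => pcat s r) (pcat p q) = obind (pcat p) (pcat q r).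
Proof.
have := pcatP p q; have := pcatP q r.
case: (altP (pend q =P pstart r)) => [Eqr [u Eu Vu]|Nqr Eu];
  case: (altP (pend p =P pstart q)) => [Epq [s Es Vs]|Npq Es];
  rewrite Eu Es //=.
- have Us : pend s = pend q.
    by rewrite /pend /pstart /pword Vs /= walk_end_cat -/(pend p) Epq.
  have Su : pstart u = pstart q by rewrite /pstart Vu.
  have := pcatP s r; have := pcatP p u.
  rewrite Us Su Epq Eqr !eqxx => -[x -> Vx] [y -> Vy].
  congr Some; apply: val_inj; rewrite [LHS]Vy [RHS]Vx /pstart /pword Vu Vs /=.
  by rewrite catA.
- have := pcatP p u; have -> : pstart u = pstart q by rewrite /pstart Vu.
  by rewrite (negbTE Npq).
- have Us : pend s = pend q.
    by rewrite /pend /pstart /pword Vs /= walk_end_cat -/(pend p) Epq.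
  by have := pcatP s r; rewrite Us (negbTE Nqr).
Qed.

Lemma pcat_triv p q v :
  (pcat p q == Some (ptriv v)) = (p == ptriv v) && (q == ptriv v).
Proof.
apply/eqP/andP=> [E|[/eqP-> /eqP->]]; last by rewrite pcat1p eqxx.
have := pcatP p q; rewrite E; case: eqP => // Epq [_ [<-]] V.
have /= Ev : v = pstart p := congr1 fst V.
have Ew : [::] = pword p ++ pword q := congr1 snd V.
have [p0 q0] : pword p = [::] /\ pword q = [::].
  by case: (pword p) (pword q) Ew => [|? ?] [|? ?].
have triv (r : qpath) : pword r = [::] -> r = ptriv (pstart r).
  by move=> r0; apply: val_inj; rewrite [RHS]/= -r0 -surjective_pairing.
have Eq : pstart q = v by rewrite -Epq (triv p p0) Ev.
by split; apply/eqP; [rewrite Ev; apply: triv | rewrite -Eq; apply: triv].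
Qed.

End Paths.

Definition path_alg (K : comNzRingType) (Q : quiver) : Type :=
  {malg K[qpath Q]}.

Section PathAlgebra.
Variables (K : comNzRingType) (Q : quiver).

Local Notation KQ := (path_alg K Q).

HB.instance Definition _ := GRing.Lmodule.on KQ.

Definition pelt (p : qpath Q) : KQ := << p >>.

Definition plin (V : lmodType K) (h : qpath Q -> V) (x : KQ) : V :=
  \sum_(p <- msupp x) x@_p *: h p.

Definition pelt_mul (p q : qpath Q) : KQ := oapp pelt 0 (pcat p q).

Definition pa_one : KQ := \sum_(v : vertex Q) pelt (ptriv v).

Definition pa_mul (x y : KQ) : KQ :=
  plin (fun p => plin (pelt_mul p) y) x.

Lemma plinEw (V : lmodType K) (h : qpath Q -> V) (d : {fset qpath Q}) (x : KQ) :
  fsubset (msupp x) d -> plin h x = \sum_(p <- d) x@_p *: h p.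
Proof.
move=> le; rewrite /plin (big_fset_incl _ le) // => p _ /mcoeff_outdom ->.
by rewrite scale0r.
Qed.

Lemma plin_linear (V : lmodType K) (h : qpath Q -> V) : linear (plin h).
Proof.
move=> c x y; pose d := fsetU (msupp x) (msupp y).
have lx : fsubset (msupp x) d by apply: fsubsetUl.
have ly : fsubset (msupp y) d by apply: fsubsetUr.
have lxy : fsubset (msupp (c *: x + y)) d.
  apply: fsubset_trans (msuppD_le _ _) _; apply: fsetSU.
  exact: msuppZ_le.
rewrite (plinEw h lx) (plinEw h ly) (plinEw h lxy).
rewrite scaler_sumr -big_split; apply: eq_bigr => p _ /=.
by rewrite mcoeffD mcoeffZ scalerDl scalerA.
Qed.

HB.instance Definition _ (V : lmodType K) (h : qpath Q -> V) :=
  GRing.isLinear.Build K KQ V *:%R (@plin V h) (@plin_linear V h).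

Lemma plin_pelt (V : lmodType K) (h : qpath Q -> V) p : plin h (pelt p) = h p.
Proof.
have le : fsubset (msupp (pelt p)) [fset p]%fset by apply: msuppU_le.
by rewrite (plinEw h le) big_seq_fset1 mcoeffUU scale1r.
Qed.

Lemma pelt_span (x : KQ) : x = plin pelt x.
Proof.
rewrite /plin {1}[x]monalgE; apply: eq_bigr => p _; apply/malgP=> q.
have E : (pelt p)@_q = 1 *+ (p == q) := mcoeffU _ _ _.
by rewrite [LHS]mcoeffU [RHS]mcoeffZ E mulrnAr mulr1.
Qed.

Lemma plin_ext (V : lmodType K) (f g : {linear KQ -> V}) :
  (forall p, f (pelt p) = g (pelt p)) -> f =1 g.
Proof.
move=> fg x; rewrite [x]pelt_span /plin !linear_sum; apply: eq_bigr => p _.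
by rewrite [LHS]linearZ [RHS]linearZ fg.
Qed.

Lemma eq_plin (V : lmodType K) (g h : qpath Q -> V) : g =1 h -> plin g =1 plin h.
Proof. by move=> gh x; apply: eq_bigr => p _; rewrite gh. Qed.

Lemma plin_comp (V W : lmodType K) (f : {linear V -> W}) (h : qpath Q -> V) x :
  f (plin h x) = plin (f \o h) x.
Proof. by rewrite /plin linear_sum; apply: eq_bigr => p _; rewrite [LHS]linearZ. Qed.

Lemma pa_mul_linearl y : linear (pa_mul^~ y).
Proof. by move=> c x x'; rewrite /pa_mul linearP. Qed.

Lemma pa_mul_linearr x : linear (pa_mul x).
Proof.
move=> c y y'.
have E z : pa_mul x z = \sum_(p <- msupp x) x@_p *: plin (pelt_mul p) z by [].
rewrite !E scaler_sumr -big_split /=; apply: eq_bigr => p _.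
by rewrite [plin _ _]linearP scalerDr !scalerA [c * _]mulrC.
Qed.

Lemma pa_mul_pelt p q : pa_mul (pelt p) (pelt q) = pelt_mul p q.
Proof. by rewrite /pa_mul !plin_pelt. Qed.

Let mull y : {linear KQ -> KQ} :=
  HB.pack (pa_mul^~ y)
    (GRing.isLinear.Build K KQ KQ *:%R (pa_mul^~ y) (pa_mul_linearl y)).
Let mulr x : {linear KQ -> KQ} :=
  HB.pack (pa_mul x)
    (GRing.isLinear.Build K KQ KQ *:%R (pa_mul x) (pa_mul_linearr x)).

Lemma pa_mulA : associative pa_mul.
Proof.
move=> x y z.
apply: (plin_ext (f := mull (pa_mul y z)) (g := mull z \o mull y)) => p /=.
apply: (plin_ext (f := mulr (pelt p) \o mull z)
                 (g := mull z \o mulr (pelt p))) => q /=.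
apply: (plin_ext (f := mulr (pelt p) \o mulr (pelt q))
                 (g := mulr (pa_mul (pelt p) (pelt q)))) => r /=.
have El : pa_mul (pelt p) (pelt_mul q r)
    = oapp pelt 0 (obind (pcat p) (pcat q r)).
  rewrite /pelt_mul; case: (pcat q r) => [u|] /=.
    by rewrite (pa_mul_pelt p u).
  exact: (raddf0 (mulr (pelt p))).
have Er : pa_mul (pelt_mul p q) (pelt r)
    = oapp pelt 0 (obind (fun s => pcat s r) (pcat p q)).
  rewrite /pelt_mul; case: (pcat p q) => [u|] /=.
    by rewrite (pa_mul_pelt u r).
  exact: (raddf0 (mull (pelt r))).
transitivity (pa_mul (pelt p) (pelt_mul q r)).
  exact: (congr1 (pa_mul (pelt p)) (pa_mul_pelt q r)).
transitivity (pa_mul (pelt_mul p q) (pelt r)).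
  by rewrite El Er pcatA.
by rewrite -(pa_mul_pelt p q).
Qed.

Lemma pa_mul1 : left_id pa_one pa_mul.
Proof.
apply: (plin_ext (f := mulr pa_one) (g := idfun)) => p.
change (mull (pelt p) pa_one = pelt p).
rewrite linear_sum (bigD1 (pstart p)) //= big1 ?addr0 => [|v /negbTE nv].
  by rewrite [LHS]pa_mul_pelt /pelt_mul pcat1p eqxx.
by rewrite [LHS]pa_mul_pelt /pelt_mul pcat1p nv.
Qed.

Lemma pa_mulr1 : right_id pa_one pa_mul.
Proof.
apply: (plin_ext (f := mull pa_one) (g := idfun)) => p.
change (mulr (pelt p) pa_one = pelt p).
rewrite linear_sum (bigD1 (pend p)) //= big1 ?addr0 => [|v nv].
  by rewrite [LHS]pa_mul_pelt /pelt_mul pcatp1 eqxx.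
by rewrite [LHS]pa_mul_pelt /pelt_mul pcatp1 eq_sym (negbTE nv).
Qed.

Lemma pa_mulDl : left_distributive pa_mul +%R.
Proof. by move=> x y z; apply: (raddfD (mull z)). Qed.

Lemma pa_mulDr : right_distributive pa_mul +%R.
Proof. by move=> x y z; apply: (raddfD (mulr x)). Qed.

Lemma pa_mul_triv v (x y : KQ) :
  (pa_mul x y)@_(ptriv v) = x@_(ptriv v) * y@_(ptriv v).
Proof.
have coefL u : linear (fun z : KQ => z@_u : K^o).
  by move=> c z z'; rewrite mcoeffD mcoeffZ.
pose cf : {linear KQ -> K^o} := HB.pack (fun z : KQ => z@_(ptriv v) : K^o)
  (GRing.isLinear.Build K KQ K^o *:%R _ (coefL (ptriv v))).
pose L c : {linear KQ -> K^o} := c \*: cf.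
have peltE p : (pelt p)@_(ptriv v) = (p == ptriv v)%:R by rewrite mcoeffU.
rewrite mulrC.
apply: (plin_ext (f := cf \o mull y) (g := L (y@_(ptriv v)))) => p.
change ((pa_mul (pelt p) y)@_(ptriv v) = y@_(ptriv v) * (pelt p)@_(ptriv v)).
rewrite [RHS]mulrC.
apply: (plin_ext (f := cf \o mulr (pelt p)) (g := L ((pelt p)@_(ptriv v)))) => q.
change ((pa_mul (pelt p) (pelt q))@_(ptriv v)
  = (pelt p)@_(ptriv v) * (pelt q)@_(ptriv v)).
rewrite (pa_mul_pelt p q) [RHS](congr2 *%R (peltE p) (peltE q)).
rewrite -natrM mulnb -pcat_triv.
rewrite /pelt_mul; case: (pcat p q) => [r|] /=; last by rewrite mcoeff0.
by rewrite (peltE r).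
Qed.

Lemma pa_one_triv v : pa_one@_(ptriv v) = 1.
Proof.
rewrite /pa_one raddf_sum (bigD1 v) //= big1 => [|u nu].
  by rewrite addr0 [LHS]mcoeffUU.
rewrite [LHS]mcoeffU; case: eqP => // /(congr1 (@pstart Q)) /eqP.
by rewrite (negbTE nu).
Qed.

Lemma pa_one_neq0 : pa_one != 0.
Proof.
apply/eqP => E; have /card_gt0P[v _] := vertex_gt0 Q.
by have /eqP := pa_one_triv v; rewrite E mcoeff0 eq_sym oner_eq0.
Qed.

HB.instance Definition _ := GRing.Zmodule_isNzRing.Build KQ
  pa_mulA pa_mul1 pa_mulr1 pa_mulDl pa_mulDr pa_one_neq0.

Lemma pa_scaleAl (c : K) (x y : KQ) : c *: (x * y) = (c *: x) * y.
Proof. exact: esym (scalable_linear (pa_mul_linearl y) c x). Qed.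

HB.instance Definition _ := GRing.Lmodule_isLalgebra.Build K KQ pa_scaleAl.

Lemma pa_scaleAr (c : K) (x y : KQ) : c *: (x * y) = x * (c *: y).
Proof. exact: esym (scalable_linear (pa_mul_linearr x) c y). Qed.

HB.instance Definition _ := GRing.Lalgebra_isAlgebra.Build K KQ pa_scaleAr.

Definition triv_coef (v : vertex Q) (x : KQ) : K := x@_(ptriv v).

Lemma triv_coef_is_zmod_morphism v : zmod_morphism (triv_coef v).
Proof. by move=> x y; rewrite /triv_coef mcoeffB. Qed.

HB.instance Definition _ v :=
  GRing.isZmodMorphism.Build KQ K (triv_coef v) (triv_coef_is_zmod_morphism v).

Lemma triv_coef_is_monoid_morphism v : monoid_morphism (triv_coef v).
Proof. by split=> [|x y]; [apply: pa_one_triv | apply: pa_mul_triv]. Qed.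

HB.instance Definition _ v :=
  GRing.isMonoidMorphism.Build KQ K (triv_coef v)
    (triv_coef_is_monoid_morphism v).

Lemma triv_coef_pelt v p : triv_coef v (pelt p) = (p == ptriv v)%:R.
Proof. exact: mcoeffU. Qed.

Definition pa_vertex (v : vertex Q) : KQ := pelt (ptriv v).
Definition pa_arrow (a : arrow Q) : KQ := pelt (parrow a).

End PathAlgebra.

Definition free_alg (K : comNzRingType) (I : choiceType) : Type :=
  {malg K[{fmonom I}]}.

Section FreeAlgebra.
Variables (K : comNzRingType) (I : choiceType).

HB.instance Definition _ := GRing.Lalgebra.on (free_alg K I).

Lemma free_scaleAr (c : K) (x y : free_alg K I) : c *: (x * y) = x * (c *: y).
Proof.
apply/malgP=> w; have le := msuppZ_le c y.
have lx := fsubset_refl (msupp x).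
rewrite [RHS](mcoeffMlw w lx le) [LHS]mcoeffZ [in LHS](mcoeffMl x y w).
rewrite mulr_sumr; apply: eq_bigr => k1 _.
rewrite mulr_sumr; apply: eq_bigr => k2 _.
by rewrite mcoeffZ mulrnAr mulrCA.
Qed.

HB.instance Definition _ :=
  GRing.Lalgebra_isAlgebra.Build K (free_alg K I) free_scaleAr.

Definition fgen (i : I) : free_alg K I := << fmu i >>.

Definition fconst (F : free_alg K I) : K := F@_(fmone I).

Lemma fconst_is_zmod_morphism : zmod_morphism fconst.
Proof. by move=> F G; rewrite /fconst mcoeffB. Qed.

HB.instance Definition _ :=
  GRing.isZmodMorphism.Build (free_alg K I) K fconst fconst_is_zmod_morphism.

Lemma fconst_is_monoid_morphism : monoid_morphism fconst.
Proof.
have [mM m1] := @mcoeff1g_is_multiplicative {fmonom I} K.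
by split=> [|F G]; [exact: m1 | exact: mM].
Qed.

HB.instance Definition _ :=
  GRing.isMonoidMorphism.Build (free_alg K I) K fconst fconst_is_monoid_morphism.

Lemma fconst_gen i : fconst (fgen i) = 0.
Proof.
rewrite [LHS]mcoeffU; case: eqP => // /(congr1 (@fdeg I)).
by rewrite fdegU [RHS]fdeg1.
Qed.

End FreeAlgebra.

(* Value at u, v of a noncommutative polynomial in two variables, computed in
   the corner algebra e A e: its constant term is sent to a multiple of e. *)
Definition eval2 (K : comNzRingType) (A : algType K) (e u v : A)
    (F : free_alg K 'I_2) : A :=
  \sum_(w <- msupp F)
    F@_w *: (e * \prod_(i <- (w : seq 'I_2)) (if i == ord0 then u else v)).

Definition corner (A : nzRingType) (e e' : A) (x : A) : Prop :=
  exists y, x = e * y * e'.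

(* s is a basis of the subspace U; V need not be finite dimensional *)
Definition is_basis (K : comNzRingType) (V : lmodType K) (U : V -> Prop)
    (s : seq V) : Prop :=
  [/\ forall v, v \in s -> U v,
      forall c : 'I_(size s) -> K, \sum_i c i *: s`_i = 0 -> forall i, c i = 0
    & forall v, U v -> exists c : 'I_(size s) -> K, v = \sum_i c i *: s`_i].

Inductive dynkinE := E6 | E7 | E8.

Definition dynkinE_rank (n : dynkinE) : nat :=
  match n with E6 => 6 | E7 => 7 | E8 => 8 end.

Coercion dynkinE_rank : dynkinE >-> nat.

(* Length of the longest nonzero paths of P(E_n) *)
Definition maxlen (n : dynkinE) : nat :=
  match n with E6 => 10 | E7 => 16 | E8 => 28 end.

Section EQuiver.
Variable n : dynkinE.
Local Open Scope nat_scope.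

(* {0, ..., n - 1} and {0, ..., 2n - 3}, in the successor form used by inord *)
Definition Evertex : finType := 'I_(n - 1).+1.
Definition Earrow : finType := 'I_(2 * n - 3).+1.

(* For i <= n - 2, a_i goes from i to Ehead i and a_(n + i - 1) goes back. *)
Definition Ehead (i : nat) : nat := if i == 0 then 3 else i.+1.

Definition Esrc (k : Earrow) : Evertex :=
  inord (if k < n - 1 then k : nat else Ehead (k - (n - 1))).

Definition Etgt (k : Earrow) : Evertex :=
  inord (if k < n - 1 then Ehead k else k - (n - 1)).

Lemma Evertex_gt0 : 0 < #|Evertex|.
Proof. by rewrite card_ord. Qed.

Definition EQ : quiver := Quiver Esrc Etgt Evertex_gt0.

End EQuiver.

Section Preprojective.
Variables (K : comNzRingType) (n : dynkinE).

Local Notation KQ := (path_alg K (EQ n)).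
Local Notation e i := (pa_vertex K (inord i : vertex (EQ n))).
Local Notation a i := (pa_arrow K (inord i : arrow (EQ n))).
Local Notation b i := (pa_arrow K (inord (n + i - 1) : arrow (EQ n))).

(* The relations of the preprojective algebra, with g added to the one at the
   vertex 3. *)
Definition Erels (g : KQ) : seq KQ :=
  [:: a 0 * b 0; a 1 * b 1; b 1 * a 1 + a 2 * b 2;
      b 0 * a 0 + b 2 * a 2 + a 3 * b 3 + g]
  ++ [seq b i * a i + a i.+1 * b i.+1 | i <- index_iota 3 (n - 2)]
  ++ [:: b (n - 2)%N * a (n - 2)%N].

Definition P_rel (r : KQ) : Prop := r \in Erels 0.

Definition Pf_rel (F : free_alg K 'I_2) (r : KQ) : Prop :=
  r \in Erels (eval2 (e 3) (b 0 * a 0) (b 2 * a 2) F) \/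
  (exists2 p : qpath (EQ n), plength p = (maxlen n).+1 & r = pelt K p).

Local Notation eps := (triv_coef (K := K) (inord 0 : vertex (EQ n))).

Lemma eps_pelt p : (0 < plength p)%N -> eps (pelt K p) = 0.
Proof. by rewrite triv_coef_pelt; case: eqP => // ->. Qed.

Lemma eps_ar (k : arrow (EQ n)) : eps (pa_arrow K k) = 0.
Proof. exact: eps_pelt. Qed.

Lemma eps_Erels g r : eps g = 0 -> r \in Erels g -> eps r = 0.
Proof.
move=> g0; have z (k l : arrow (EQ n)) : eps (pa_arrow K k * pa_arrow K l) = 0.
  exact: etrans (rmorphM eps _ _) (etrans (congr1 ( *%R^~ _) (eps_ar k)) (mul0r _)).
have zD u v : eps u = 0 -> eps v = 0 -> eps (u + v) = 0.
  move=> u0 v0; apply: etrans (raddfD eps u v) _.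
  exact: etrans (congr2 +%R u0 v0) (addr0 0).
rewrite /Erels !mem_cat => /or3P[||/[!inE] /eqP->]; last exact: z.
  rewrite !inE => /or4P[] /eqP->.
  - exact: z.
  - exact: z.
  - exact: zD (z _ _) (z _ _).
  - exact: zD (zD _ _ (zD _ _ (z _ _) (z _ _)) (z _ _)) g0.
by case/mapP => i _ ->; exact: zD (z _ _) (z _ _).
Qed.

Lemma P_rel_proper : ~ ideal_gen P_rel 1.
Proof.
apply: (ideal_gen_morph (eps := eps)).
  exact: triv_coef_is_monoid_morphism.
by move=> r; apply: eps_Erels; apply: raddf0.
Qed.

Lemma eps_eval2 u v F : eps (eval2 (e 3) u v F) = 0.
Proof.
have e0 : eps (e 3) = 0.
  rewrite [LHS]triv_coef_pelt; case: eqP => // /(congr1 (@pstart _)).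
  by move/(congr1 val); rewrite /= !inordK //; case: n.
apply: etrans (raddf_sum eps _ _ _) _; apply: big1 => w _.
rewrite -mulr_algl; apply: etrans (rmorphM eps _ _) _.
rewrite [X in _ * X](_ : _ = 0) ?mulr0 //; apply: etrans (rmorphM eps _ _) _.
exact: etrans (congr1 ( *%R^~ _) e0) (mul0r _).
Qed.

Lemma Pf_rel_proper F : ~ ideal_gen (Pf_rel F) 1.
Proof.
apply: (ideal_gen_morph (eps := eps)).
  exact: triv_coef_is_monoid_morphism.
move=> r [|[p lp ->]]; last by apply: eps_pelt; rewrite lp.
by apply: eps_Erels; apply: eps_eval2.
Qed.

Local Notation x := (fgen K (ord0 : 'I_2)).
Local Notation y := (fgen K (ord_max : 'I_2)).

Definition R_rel (r : free_alg K 'I_2) : Prop :=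
  r \in [:: x ^+ 2; y ^+ 3; (x + y) ^+ (n - 3)].

Lemma R_rel_proper : ~ ideal_gen R_rel 1.
Proof.
apply: (ideal_gen_morph (eps := fconst (K := K) (I := 'I_2))).
  exact: fconst_is_monoid_morphism.
have x0 : fconst x = 0 := fconst_gen K _.
have y0 : fconst y = 0 := fconst_gen K _.
have xy0 : fconst (x + y) = 0.
  exact: etrans (raddfD (fconst (I := 'I_2)) x y) (etrans (congr2 +%R x0 y0) (addr0 0)).
have X0 (F : free_alg K 'I_2) k : fconst F = 0 -> (0 < k)%N -> fconst (F ^+ k) = 0.
  move=> F0 k0; apply: etrans (rmorphXn (fconst (I := 'I_2)) k F) _.
  apply: etrans (congr1 (fun c => c ^+ k) F0) _.
  by rewrite expr0n; case: k k0.
move=> r; rewrite /R_rel !inE => /or3P[] /eqP->; apply: X0 => //.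
by case: n.
Qed.

End Preprojective.

Definition R_E (K : comNzRingType) (n : dynkinE) : algType K :=
  quot_alg (@R_rel_proper K n).

Definition R_class (K : comNzRingType) (n : dynkinE) (F : free_alg K 'I_2) :
    R_E K n :=
  qproj (@R_rel_proper K n) F.

Definition R_x (K : comNzRingType) (n : dynkinE) : R_E K n :=
  R_class n (fgen K ord0).
Definition R_y (K : comNzRingType) (n : dynkinE) : R_E K n :=
  R_class n (fgen K ord_max).

Definition admissible (K : comNzRingType) (n : dynkinE) (f : R_E K n) : Prop :=
  jacobson_radical2 f /\ (R_x K n + R_y K n + f) ^+ (n - 3) = 0.

Definition P_E (K : comNzRingType) (n : dynkinE) : algType K :=
  quot_alg (@P_rel_proper K n).

Definition P_vertex (K : comNzRingType) (n : dynkinE) (v : vertex (EQ n)) :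
    P_E K n :=
  qproj (@P_rel_proper K n) (pa_vertex K v).

Definition P_arrow (K : comNzRingType) (n : dynkinE) (a : arrow (EQ n)) :
    P_E K n :=
  qproj (@P_rel_proper K n) (pa_arrow K a).

(* P^f(E_n), where F is the noncommutative polynomial representing f *)
Definition Pf_E (K : comNzRingType) (n : dynkinE) (F : free_alg K 'I_2) :
    algType K :=
  quot_alg (@Pf_rel_proper K n F).

Definition Pf_vertex (K : comNzRingType) (n : dynkinE) (F : free_alg K 'I_2)
    (v : vertex (EQ n)) : Pf_E n F :=
  qproj (@Pf_rel_proper K n F) (pa_vertex K v).

Definition Pf_arrow (K : comNzRingType) (n : dynkinE) (F : free_alg K 'I_2)
    (a : arrow (EQ n)) : Pf_E n F :=
  qproj (@Pf_rel_proper K n F) (pa_arrow K a).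

Definition P_path (K : comNzRingType) (n : dynkinE) (w : seq (arrow (EQ n))) :
    P_E K n :=
  \prod_(a <- w) P_arrow K a.

(* Main.v *)
Require Import Defs.
From HB Require Import structures.
From mathcomp Require Import all_boot all_algebra zify.
From mathcomp Require Import boolp.
From mathcomp Require Import finmap.
From mathcomp.multinomials Require Import monalg.

(* Let J be the arrow ideal of A = KQ, I the homogeneous ideal of P and I_f the
   ideal of P^f.  Since f has order at least 2, the relations of P are the
   leading forms of those of P^f, so the degree d part of an element of I lies
   in I_f + J^(d+1).  Since phi is the identity modulo higher order terms,
   phi [x]_f = 0 with x in J^d forces the degree d part of x into
   I_f + J^(d+1); by induction x lies in I_f + J^N for all N, and J^(m+1) is
   contained in I_f, so phi is injective.  Dually every element of P is in the
   image of phi modulo the image of J^N for all N, so phi is surjective once J is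
   nilpotent modulo I.  The bases give this: a path parallel to an arrow and
   longer than m is, modulo I, a combination of elements of smaller degree,
   hence lies in I, and a long enough path contains such a subpath by the
   pigeonhole principle. *)

Set Implicit Arguments.
Unset Strict Implicit.
Unset Printing Implicit Defensive.

Import GRing.Theory.

Local Open Scope ring_scope.

(** * Quotients by two-sided ideals and inverses of algebra homomorphisms *)

Lemma ideal_genZ (K : comNzRingType) (A : algType K) (S : A -> Prop) (c : K) x :
  ideal_gen S x -> ideal_gen S (c *: x).
Proof. by rewrite -mulr_algl; apply: ideal_genMl. Qed.

Lemma qproj_ideal (K : comNzRingType) (A : algType K) (S : A -> Prop)
    (proper : ~ ideal_gen S 1) x : qproj proper x = 0 <-> ideal_gen S x.
Proof.
split=> [x0|Ix].
  rewrite -[x]subr0; apply/(qproj_eq proper).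
  by rewrite x0 raddf0.
by rewrite -(raddf0 (qproj proper)); apply/(qproj_eq proper); rewrite subr0.
Qed.

Lemma bijective_lrmorphism_inverse (K : comNzRingType) (A B : algType K)
    (phi : {lrmorphism A -> B}) :
  injective phi -> (forall b, exists a, phi a = b) ->
  exists psi : {lrmorphism B -> A}, cancel phi psi /\ cancel psi phi.
Proof.
move=> phi_inj /choice [psi psiK].
have phiK : cancel phi psi by move=> a; apply: phi_inj.
have psiB : zmod_morphism psi.
  by move=> x y; apply: phi_inj; rewrite rmorphB /= !psiK.
have psiM : monoid_morphism psi.
  split; first by apply: phi_inj; rewrite psiK rmorph1.
  by move=> x y; apply: phi_inj; rewrite rmorphM /= !psiK.
have psiZ : scalable psi.
  by move=> c x; apply: phi_inj; rewrite linearZ /= !psiK.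
pose psi' : {lrmorphism B -> A} := HB.pack psi
  (GRing.isZmodMorphism.Build B A psi psiB)
  (GRing.isMonoidMorphism.Build B A psi psiM)
  (GRing.isScalable.Build K B A *:%R psi psiZ).
by exists psi'.
Qed.

(* The path algebra, seen through its basis of paths, the length of a path and
   the projections onto homogeneous parts.  Working over an abstract algebra
   prevents unification from unfolding the concrete product of paths. *)
Record length_basis (K : comNzRingType) (A : algType K) := LengthBasis {
  idx : Type;
  len : idx -> nat;
  elt : idx -> A;
  part : nat -> A -> A;
  part_linear : forall d, linear (part d);
  part_elt : forall d p, part d (elt p) = if len p == d then elt p else 0;
  elt_ind : forall C : A -> Prop,
    C 0 -> (forall x y, C x -> C y -> C (x + y)) ->
    (forall (c : K) x, C x -> C (c *: x)) -> (forall p, C (elt p)) ->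
    forall x, C x;
  eltM : forall p q, elt p * elt q = 0 \/
    exists2 r, len r = (len p + len q)%N & elt p * elt q = elt r
}.

(** * The length grading and its filtration *)

Section Grading.
Variables (K : comNzRingType) (A : algType K) (B : length_basis A).

Local Notation len := (@len K A B).
Local Notation elt := (@elt K A B).
Local Notation part := (@part K A B).

(** For paths this is the [d]-th power of the arrow ideal. Presenting it as a linear span lets
    claims about it be proved by induction down to basis elements. *)
Inductive deg_ge (d : nat) : A -> Prop :=
| deg_ge0 : deg_ge d 0
| deg_geD x y : deg_ge d x -> deg_ge d y -> deg_ge d (x + y)
| deg_geZ (c : K) x : deg_ge d x -> deg_ge d (c *: x)
| deg_ge_elt p : (d <= len p)%N -> deg_ge d (elt p).

Lemma deg_ge_all x : deg_ge 0 x.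
Proof.
elim/(@elt_ind K A B): x; [exact: deg_ge0 | exact: deg_geD | exact: deg_geZ |].
by move=> p; apply: deg_ge_elt.
Qed.

Lemma deg_geW d e x : (d <= e)%N -> deg_ge e x -> deg_ge d x.
Proof.
move=> de; elim=> {x} [|x y _ Hx _ Hy|c x _ Hx|p pe]; [exact: deg_ge0 |
  exact: deg_geD | exact: deg_geZ | exact: deg_ge_elt (leq_trans de pe)].
Qed.

Lemma deg_geN d x : deg_ge d x -> deg_ge d (- x).
Proof. by rewrite -scaleN1r; apply: deg_geZ. Qed.

Lemma deg_ge_sum d (I : Type) (r : seq I) (P : pred I) (F : I -> A) :
  (forall i, P i -> deg_ge d (F i)) -> deg_ge d (\sum_(i <- r | P i) F i).
Proof.
by move=> HF; apply: big_ind => //; [apply: deg_ge0 | apply: deg_geD].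
Qed.

Lemma deg_geM d e x y : deg_ge d x -> deg_ge e y -> deg_ge (d + e) (x * y).
Proof.
move=> Hx Hy; elim: Hx => {x} [|x x' _ Hx _ Hx'|c x _ Hx|p dp].
- by rewrite mul0r; apply: deg_ge0.
- by rewrite mulrDl; apply: deg_geD.
- by rewrite -scalerAl; apply: deg_geZ.
elim: Hy => {y} [|y y' _ Hy _ Hy'|c y _ Hy|q eq].
- by rewrite mulr0; apply: deg_ge0.
- by rewrite mulrDr; apply: deg_geD.
- by rewrite -scalerAr; apply: deg_geZ.
have [->|[r Er ->]] := eltM p q; first exact: deg_ge0.
by apply: deg_ge_elt; rewrite Er leq_add.
Qed.

Lemma deg_ge_prod (I : Type) (r : seq I) d (F : I -> A) :
  (forall i, deg_ge d (F i)) -> deg_ge (d * size r) (\prod_(i <- r) F i).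
Proof.
move=> HF; elim: r => [|i r IH]; first by rewrite muln0; apply: deg_ge_all.
by rewrite big_cons mulnS; apply: deg_geM.
Qed.

Lemma part0 d : part d 0 = 0.
Proof.
by have := part_linear B d (-1) 0 0; rewrite scaler0 add0r scaleN1r addNr.
Qed.

Lemma partD d x y : part d (x + y) = part d x + part d y.
Proof. by have := part_linear B d 1 x y; rewrite !scale1r. Qed.

Lemma partZ d c x : part d (c *: x) = c *: part d x.
Proof. by have := part_linear B d c x 0; rewrite part0 !addr0. Qed.

Lemma partB d x y : part d (x - y) = part d x - part d y.
Proof. by rewrite partD -scaleN1r partZ scaleN1r. Qed.

Lemma part_deg_gt d x : deg_ge d.+1 x -> part d x = 0.
Proof.
elim=> {x} [|x y _ x0 _ y0|c x _ x0|p dp]; first exact: part0.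
- by rewrite partD x0 y0 addr0.
- by rewrite partZ x0 scaler0.
by rewrite part_elt gtn_eqF.
Qed.

Lemma deg_ge_part_rest d x : deg_ge d x -> deg_ge d.+1 (x - part d x).
Proof.
elim=> {x} [|x y _ Hx _ Hy|c x _ Hx|p].
- by rewrite part0 subr0; apply: deg_ge0.
- by rewrite partD opprD addrACA; apply: deg_geD.
- by rewrite partZ -scalerBr; apply: deg_geZ.
rewrite part_elt; case: ltngtP => // [dp _|_ _].
  by rewrite subr0; apply: deg_ge_elt.
by rewrite subrr; apply: deg_ge0.
Qed.

(** The guard deals with truncated subtraction: for [d < len p] the product has nothing in degree
    [d], whereas [part (d - len p) x] would be the degree 0 component. *)
Lemma partMl d p x : part d (elt p * x) =
  if (len p <= d)%N then elt p * part (d - len p) x else 0.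
Proof.
elim/(@elt_ind K A B): x => [|x y Ex Ey|c x Ex|q].
- by rewrite mulr0 !part0 mulr0 if_same.
- by rewrite mulrDr !partD Ex Ey; case: ifP; rewrite (mulrDr, addr0).
- by rewrite -scalerAr !partZ Ex; case: ifP; rewrite -?scalerAr ?scaler0.
rewrite part_elt (fun_if ( *%R (elt p))) mulr0.
have [->|[r Er ->]] := eltM p q; first by rewrite part0 !if_same.
have -> : part d (elt r) = if (len p <= d)%N && (len q == d - len p)%N
    then elt r else 0 by rewrite part_elt Er; congr (if _ then _ else _); lia.
by case: (len p <= d)%N.
Qed.

Lemma partMr d p x : part d (x * elt p) =
  if (len p <= d)%N then part (d - len p) x * elt p else 0.
Proof.
elim/(@elt_ind K A B): x => [|x y Ex Ey|c x Ex|q].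
- by rewrite mul0r !part0 mul0r if_same.
- by rewrite mulrDl !partD Ex Ey; case: ifP; rewrite (mulrDl, addr0).
- by rewrite -scalerAl !partZ Ex; case: ifP; rewrite -?scalerAl ?scaler0.
rewrite part_elt (fun_if ( *%R^~ (elt p))) mul0r.
have [->|[r Er ->]] := eltM q p; first by rewrite part0 !if_same.
have -> : part d (elt r) = if (len p <= d)%N && (len q == d - len p)%N
    then elt r else 0 by rewrite part_elt Er; congr (if _ then _ else _); lia.
by case: (len p <= d)%N.
Qed.

(** Multiplication by a basis element only shifts degrees, and every multiplier is a combination of
    basis elements; so a family of subspaces compatible with the shifts has to be tested on
    generators alone. It serves both for homogeneous ideals and for leading forms. *)
Lemma ideal_gen_part (S : A -> Prop) (N : nat -> A -> Prop) :
  (forall d, N d 0) ->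
  (forall d x y, N d x -> N d y -> N d (x + y)) ->
  (forall d (c : K) x, N d x -> N d (c *: x)) ->
  (forall d p x, N d x -> N (len p + d)%N (elt p * x)) ->
  (forall d p x, N d x -> N (d + len p)%N (x * elt p)) ->
  (forall d s, S s -> N d (part d s)) ->
  forall x, ideal_gen S x -> forall d, N d (part d x).
Proof.
move=> N0 ND NZ Nl Nr NS x.
elim=> {x} [s Ss d||x y _ Nx _ Ny d|a x _ Nx|x a _ Nx].
- exact: NS.
- by move=> d; rewrite part0.
- by rewrite partD; apply: ND.
- elim/(@elt_ind K A B): a => [d|a b Na Nb d|c a Na d|p d].
  + by rewrite mul0r part0.
  + by rewrite mulrDl partD; apply: ND.
  + by rewrite -scalerAl partZ; apply: NZ.
  rewrite partMl; case: leqP => // pd.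
  by rewrite -{1}(subnKC pd); apply: Nl.
- elim/(@elt_ind K A B): a => [d|a b Na Nb d|c a Na d|p d].
  + by rewrite mulr0 part0.
  + by rewrite mulrDr partD; apply: ND.
  + by rewrite -scalerAr partZ; apply: NZ.
  rewrite partMr; case: leqP => // pd.
  by rewrite -{1}(subnK pd); apply: Nr.
Qed.

Definition homog (d : nat) (x : A) : Prop :=
  forall e, part e x = if e == d then x else 0.

Lemma homog0 d : homog d 0.
Proof. by move=> e; rewrite part0 if_same. Qed.

Lemma homogD d x y : homog d x -> homog d y -> homog d (x + y).
Proof. by move=> Hx Hy e; rewrite partD Hx Hy; case: eqP; rewrite ?addr0. Qed.

Lemma homogZ d c x : homog d x -> homog d (c *: x).
Proof. by move=> Hx e; rewrite partZ Hx; case: eqP; rewrite ?scaler0. Qed.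

Lemma homog_sum d (I : Type) (r : seq I) (P : pred I) (F : I -> A) :
  (forall i, P i -> homog d (F i)) -> homog d (\sum_(i <- r | P i) F i).
Proof. by move=> HF; apply: big_ind => //; [apply: homog0 | apply: homogD]. Qed.

Lemma homog_elt p : homog (len p) (elt p).
Proof. by move=> e; rewrite part_elt eq_sym. Qed.

Lemma homog_eltM p q : homog (len p + len q) (elt p * elt q).
Proof.
by have [->|[r <- ->]] := eltM p q; [apply: homog0 | apply: homog_elt].
Qed.

Lemma homogM d e x y : homog d x -> homog e y -> homog (d + e) (x * y).
Proof.
(* Replacing [x] and [y] by [part d x] and [part e y] gives a claim about arbitrary [x] and [y],
   open to induction on the basis. *)
move=> /(_ d) + /(_ e); rewrite !eqxx => <- <-.
elim/(@elt_ind K A B): x => [|x x' Hx Hx'|c x Hx|p].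
- by rewrite part0 mul0r; apply: homog0.
- by rewrite partD mulrDl; apply: homogD.
- by rewrite partZ -scalerAl; apply: homogZ.
elim/(@elt_ind K A B): y => [|y y' Hy Hy'|c y Hy|q].
- by rewrite part0 mulr0; apply: homog0.
- by rewrite partD mulrDr; apply: homogD.
- by rewrite partZ -scalerAr; apply: homogZ.
rewrite !part_elt; case: eqP => [<-|_]; last by rewrite mul0r; apply: homog0.
case: eqP => [<-|_]; last by rewrite mulr0; apply: homog0.
exact: homog_eltM.
Qed.

(** This is [ideal_gen_part] for the constant family equal to the ideal: a component of a generator
    is the generator or 0. *)
Lemma homogeneous_ideal_part (S : A -> Prop) (m : nat) :
  (forall s, S s -> homog m s) ->
  forall x d, ideal_gen S x -> ideal_gen S (part d x).
Proof.
move=> Sm x d /(ideal_gen_part (N := fun=> ideal_gen S)); apply=> {x d} //.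
- by move=> _; apply: ideal_gen0.
- by move=> _; apply: ideal_genD.
- by move=> _; apply: ideal_genZ.
- by move=> _ p; apply: ideal_genMl.
- by move=> _ p x; apply: ideal_genMr.
move=> d s Ss; rewrite (Sm s Ss); case: eqP => _; last exact: ideal_gen0.
exact: ideal_gen_in.
Qed.

End Grading.

(** * Homomorphisms that are the identity up to higher degree *)

Section Deformation.
Variables (K : comNzRingType) (A : algType K) (B : length_basis A).
Variables (V I : Type) (ver : V -> A) (arr : I -> A).
Hypothesis elt_prod :
  forall p, exists v w,
    size w = len p /\ @elt _ _ B p = ver v * \prod_(a <- w) arr a.
Hypothesis arr_deg : forall a, deg_ge B 1 (arr a).
(** [S] plays the role of the relations of $P(\mathbb{E}_n)$ and [S'] that of the relations of
    $P^f(\mathbb{E}_n)$. *)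
Variables (S S' : A -> Prop) (N N' : nat).
Hypotheses (proper : ~ ideal_gen S 1) (proper' : ~ ideal_gen S' 1).
Hypothesis S_homog : forall s, S s -> homog B 2 s.
Hypothesis S_S' :
  forall s, S s -> exists2 g, deg_ge B 3 g & ideal_gen S' (s + g).
Hypothesis nilp : forall x, deg_ge B N x -> ideal_gen S x.
Hypothesis nilp' : forall x, deg_ge B N' x -> ideal_gen S' x.

Local Notation pi := (qproj proper).
Local Notation pi' := (qproj proper').

Variable phi : {lrmorphism quot_alg proper' -> quot_alg proper}.
Hypothesis phi_ver : forall v, phi (pi' (ver v)) = pi (ver v).
Hypothesis phi_arr :
  forall a, exists2 h, deg_ge B 2 h & phi (pi' (arr a)) = pi (arr a + h).

(** Vertices are fixed exactly and arrows up to degree 2, so expanding the image of a path gives the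
    path plus terms in which some arrow has become longer. *)
Lemma phi_leading d x : deg_ge B d x ->
  exists2 y, deg_ge B d.+1 y & phi (pi' x) = pi (x + y).
Proof.
elim=> {x} [|x x' _ [y Hy Ey] _ [y' Hy' Ey']|c x _ [y Hy Ey]|p dp].
- by exists 0; [apply: deg_ge0 | rewrite addr0 !rmorph0].
- exists (y + y'); first exact: deg_geD.
  by rewrite !raddfD /= Ey Ey' -!raddfD /= addrACA.
- exists (c *: y); first exact: deg_geZ.
  by rewrite !linearZ /= Ey -linearZ /= scalerDr.
have [v [w [sw ->]]] := elt_prod p.
suff [y Hy Ey] : exists2 y, deg_ge B (size w).+1 y &
    phi (pi' (\prod_(a <- w) arr a)) = pi (\prod_(a <- w) arr a + y).
  exists (ver v * y).
    apply: deg_geW (deg_geM (deg_ge_all B (ver v)) Hy).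
    by rewrite add0n sw.
  by rewrite !rmorphM /= phi_ver Ey -rmorphM /= mulrDr.
elim: w {sw} => [|a w [y Hy Ey]].
  by exists 0; [apply: deg_ge0 | rewrite big_nil addr0 !rmorph1].
have [h Hh Eh] := phi_arr a.
(* With [W] the product over [w], this is all of [(arr a + h) * (W + y)] except [arr a * W]; both
   summands have degree at least [size w + 2]. *)
exists (arr a * y + h * (\prod_(b <- w) arr b + y)).
  apply: deg_geD; first exact: (deg_geM (arr_deg a) Hy).
  apply: (deg_geM Hh); apply: deg_geD (deg_geW (leqnSn _) Hy).
  by have := deg_ge_prod w arr_deg; rewrite mul1n.
by rewrite !big_cons !rmorphM /= Eh Ey -rmorphM /= mulrDl addrA mulrDr.
Qed.

(** The ideal of [S'] and the filtration are both compatible with degree shifts, so [ideal_gen_part]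
    reduces the claim to the relations in [S]. *)
Lemma ideal_gen_leading x d : ideal_gen S x ->
  exists i y, [/\ ideal_gen S' i, deg_ge B d.+1 y & part B d x = i + y].
Proof.
pose C d x := exists i y, [/\ ideal_gen S' i, deg_ge B d.+1 y & x = i + y].
move=> Sx; suff : forall d, C d (part B d x) by apply.
apply: ideal_gen_part Sx => {x d}.
- move=> d; exists 0, 0; rewrite addr0.
  by split=> //; [exact: ideal_gen0 | exact: deg_ge0].
- move=> d _ _ [i [y [Hi Hy ->]]] [j [z [Hj Hz ->]]]; exists (i + j), (y + z).
  by split; [exact: ideal_genD | exact: deg_geD | rewrite addrACA].
- move=> d c _ [i [y [Hi Hy ->]]]; exists (c *: i), (c *: y).
  by split; [exact: ideal_genZ | exact: deg_geZ | rewrite scalerDr].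
- move=> d p _ [i [y [Hi Hy ->]]]; exists (elt p * i), (elt p * y); split.
  + exact: ideal_genMl.
  + by rewrite -addnS; apply: deg_geM Hy; apply: deg_ge_elt.
  + by rewrite mulrDr.
- move=> d p _ [i [y [Hi Hy ->]]]; exists (i * elt p), (y * elt p); split.
  + exact: ideal_genMr.
  + by rewrite -addSn; apply: deg_geM Hy _; apply: deg_ge_elt.
  + by rewrite mulrDl.
(* In degree 2 the relation is [s + g] minus [g], with [s + g] in the ideal of [S']; its other
   components are 0. *)
move=> d s Ss; rewrite (S_homog Ss); case: eqP => [->|_].
  have [g Hg Ig] := S_S' Ss; exists (s + g), (- g).
  by split; [|exact: deg_geN|rewrite addrK].
exists 0, 0; rewrite addr0.
by split=> //; [exact: ideal_gen0 | exact: deg_ge0].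
Qed.

Lemma phi_injective : injective phi.
Proof.
suff phi0 u : phi u = 0 -> u = 0.
  by move=> u v /eqP; rewrite -subr_eq0 -rmorphB => /eqP/phi0/eqP;
     rewrite subr_eq0 => /eqP.
have [x ->] := qprojP u => phix.
(* At [d = N'] the remainder [y] is itself in the ideal of [S'], by [nilp']. *)
suff /(_ N') [i [y [Hi Hy ->]]] : forall d, exists i y,
    [/\ ideal_gen S' i, deg_ge B d y & x = i + y].
  by apply/qproj_ideal/ideal_genD => //; apply: nilp'.
elim=> [|d [i [y [Hi Hy Ex]]]].
  exists 0, x; rewrite add0r.
  by split=> //; [exact: ideal_gen0 | exact: deg_ge_all].
have [z Hz Ez] := phi_leading Hy.
(* Since [i] vanishes in the source, [phi] sends the class of [x] to that of [y + z], which is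
   therefore 0. *)
have Iyz : ideal_gen S (y + z).
  apply/(qproj_ideal proper); rewrite -Ez -phix Ex rmorphD rmorphD /=.
  by have /(qproj_ideal proper') -> := Hi; rewrite rmorph0 add0r.
have [j [t [Hj Ht Ejt]]] := ideal_gen_leading d Iyz.
(* As [z] starts in degree [d + 1], the degree [d] component of [y + z] is that of [y]; it is traded
   for [j + t], and the rest of [y] starts in degree [d + 1]. *)
exists (i + j), (t + (y - part B d y)); split; first exact: ideal_genD.
  by apply: deg_geD => //; apply: deg_ge_part_rest.
rewrite partD (part_deg_gt Hz) addr0 in Ejt.
by rewrite Ex Ejt -addrA (addrA j) (addrC (j + t)) subrK.
Qed.

Lemma phi_surjective u : exists v, phi v = u.
Proof.
have [x ->] := qprojP u.
suff /(_ N) [v [y [/nilp/(qproj_ideal proper) y0 ->]]] :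
    forall d, exists v y, deg_ge B d y /\ pi x = phi v + pi y.
  by exists v; rewrite y0 addr0.
elim=> [|d [v [y [Hy ->]]]].
  by exists 0, x; rewrite rmorph0 add0r; split=> //; apply: deg_ge_all.
have [z Hz Ez] := phi_leading Hy.
(* Correcting the approximate preimage by [pi' y] overshoots only by [pi z], which lies one degree
   deeper. *)
exists (v + pi' y), (- z); split; first exact: deg_geN.
by rewrite rmorphD /= Ez -addrA -rmorphD /= addrK.
Qed.

End Deformation.

(** * Paths as a graded basis, and nilpotency of the arrow ideal *)

Section PathAlgebraGrading.
Variables (K : comNzRingType) (Q : quiver).
Local Notation KQ := (path_alg K Q).

Lemma pelt_mulE (p q r : qpath Q) :
  pend p = pstart q -> val r = (pstart p, pword p ++ pword q) ->
  pelt K p * pelt K q = pelt K r.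
Proof.
move=> Epq Er; apply: etrans (pa_mul_pelt K p q) _.
rewrite /pelt_mul; have := pcatP p q.
by rewrite Epq eqxx => -[s -> Es]; congr pelt; apply: val_inj; rewrite Es.
Qed.

Lemma pelt_corner (p : qpath Q) :
  pelt K p = pa_vertex K (pstart p) * pelt K p * pa_vertex K (pend p).
Proof.
have El : pa_vertex K (pstart p) * pelt K p = pelt K p.
  by apply: etrans (pa_mul_pelt K _ _) _; rewrite /pelt_mul pcat1p eqxx.
have Er : pelt K p * pa_vertex K (pend p) = pelt K p.
  by apply: etrans (pa_mul_pelt K _ _) _; rewrite /pelt_mul pcatp1 eqxx.
apply/esym/(etrans _ Er).
exact: (congr1 (fun z : KQ => z * pa_vertex K (pend p)) El).
Qed.

Lemma pelt_mulP (p q : qpath Q) : pelt K p * pelt K q = 0 \/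
  exists2 r, plength r = (plength p + plength q)%N &
    pelt K p * pelt K q = pelt K r.
Proof.
have Epq := pa_mul_pelt K p q.
have := pcatP p q; case: eqP => [_ [r Er Vr]|_ E0].
  right; exists r; last by apply: etrans Epq _; rewrite /pelt_mul Er.
  by rewrite /plength -size_cat; congr size; apply: (congr1 snd Vr).
by left; apply: etrans Epq _; rewrite /pelt_mul E0.
Qed.

Lemma pelt_ind (C : KQ -> Prop) :
  C 0 -> (forall x y, C x -> C y -> C (x + y)) ->
  (forall (c : K) x, C x -> C (c *: x)) -> (forall p, C (pelt K p)) ->
  forall x, C x.
Proof.
move=> C0 CD CZ Cp x; rewrite [x]pelt_span /plin.
by apply: big_ind => // p _; apply/CZ/Cp.
Qed.

Definition path_basis : length_basis (path_alg K Q : algType K) :=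
  @LengthBasis K KQ (qpath Q) (@plength Q) (@pelt K Q)
    (fun d => plin (fun p => if plength p == d then pelt K p else 0))
    (fun d => plin_linear _) (fun d p => plin_pelt _ p) pelt_ind pelt_mulP.

(** The vertex factor records a trivial path, whose word gives the empty product 1; on longer paths
    the first arrow absorbs it. *)
Lemma pelt_prod (p : qpath Q) :
  pelt K p = pa_vertex K (pstart p) * \prod_(a <- pword p) pa_arrow K a.
Proof.
case: p => -[v w] /= wP; rewrite /pstart /pword /=.
elim: w v wP => [|a w IH] v wP.
  by rewrite big_nil mulr1; congr pelt; apply: val_inj.
case/andP: (wP) => /= /eqP av aw.
have Ev : pa_vertex K v * pa_arrow K a = pa_arrow K a.
  by apply: pelt_mulE => //=; rewrite av.
have Ea : pa_arrow K a * pa_vertex K (tgt a) = pa_arrow K a by apply: pelt_mulE.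
(* The identities $e_v a = a = a e_{t(a)}$ move the vertex factor past the first arrow, where the
   induction hypothesis for [w] needs it. *)
have vaE (x : KQ) : pa_vertex K v * (pa_arrow K a * x)
    = pa_arrow K a * (pa_vertex K (tgt a) * x).
  apply: etrans (mulrA _ _ _) (etrans _ (esym (mulrA _ _ _))).
  exact: (congr1 (fun z : KQ => z * x) (etrans Ev (esym Ea))).
rewrite big_cons vaE.
apply: etrans (congr1 (fun z : KQ => pa_arrow K a * z) (IH (tgt a) aw)).
by apply/esym/pelt_mulE => //=; rewrite -av.
Qed.

Lemma deg_ge_arrow a : deg_ge path_basis 1 (pa_arrow K a).
Proof. exact: (@deg_ge_elt _ _ path_basis 1 (parrow a)). Qed.

Lemma homog_arrow a : homog path_basis 1 (pa_arrow K a).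
Proof. exact: (@homog_elt _ _ path_basis (parrow a)). Qed.

Lemma homog_one : homog path_basis 0 1.
Proof.
apply: (@homog_sum _ _ path_basis 0 _ _ predT
  (fun v => pelt K (ptriv v) : KQ)) => v _.
exact: (@homog_elt _ _ path_basis (ptriv v)).
Qed.

Lemma homog_arrow_prod (w : seq (arrow Q)) :
  homog path_basis (size w) (\prod_(a <- w) pa_arrow K a).
Proof.
elim: w => [|a w IH]; first by rewrite big_nil; apply: homog_one.
by rewrite big_cons; apply: (homogM (homog_arrow a) IH).
Qed.

Lemma path_split (d : nat) (p : qpath Q) : (d <= plength p)%N ->
  exists p1 p2, plength p1 = d /\ pelt K p = pelt K p1 * pelt K p2.
Proof.
case: p => -[v w] wP; rewrite /plength /pword /= => dw.
have := wP; rewrite /= -{1}(cat_take_drop d w) is_walk_cat => /andP[w1P w2P].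
exists (@QPath Q (v, take d w) w1P).
exists (@QPath Q (walk_end v (take d w), drop d w) w2P).
split; first exact: size_takel.
apply/esym/pelt_mulE => //=.
by rewrite /pstart /pword /= cat_take_drop.
Qed.

(* A long path visits some vertex twice, at places more than m apart; completed
   by the next arrow k, the part in between is parallel to k. *)
Lemma long_path_parallel (m : nat) (p : qpath Q) :
  (#|vertex Q| * m.+1 < plength p)%N ->
  exists k p1 p2 p3, [/\ pstart p2 = src k, pend p2 = tgt k,
    (m < plength p2)%N &
    pelt K p = pelt K p1 * pelt K p2 * pelt K p3].
Proof.
move=> mp; pose v := pstart p; pose w := pword p.
have wP : is_walk v w by apply: valP p.
(* Prefixes are sampled at multiples of [m.+1]: there is one more sample than vertices, and distinct
   samples are more than [m] arrows apart. *)
pose f (i : 'I_#|vertex Q|.+1) := walk_end v (take (i * m.+1) w).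
have : ~~ injectiveb f.
  by apply/negP=> /injectiveP/leq_card; rewrite card_ord ltnn.
case/injectivePn => i0 [j0 + f0].
wlog ltij : i0 j0 f0 / (i0 < j0)%N => [IH|_].
  by rewrite neq_ltn => /orP[] lt; [apply: (IH i0 j0) | apply: (IH j0 i0)];
    rewrite // neq_ltn lt ?orbT.
set a := (i0 * m.+1)%N; pose b := (j0 * m.+1)%N.
have ab : (a + m < b)%N.
  by rewrite /a /b -addnS -mulSnr leq_mul2r ltij orbT.
(* Strictness leaves an arrow [k] after the closed walk [w2]; appending it makes [rcons w2 k]
   parallel to [k]. *)
have bw : (b < size w)%N.
  by apply: leq_ltn_trans mp; rewrite leq_mul2r -ltnS ltn_ord orbT.
set w1 := take a w; pose w2 := take (b - a) (drop a w).
have Ew12 : take b w = w1 ++ w2 by rewrite -takeD; congr take; lia.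
case Ew3 : (drop b w) => [|k w3].
  by have := size_drop b w; rewrite Ew3 /=; lia.
have Ew : w = (w1 ++ rcons w2 k) ++ w3.
  by rewrite -(cat_take_drop b w) Ew12 Ew3 -cats1 -!catA.
have w2u : walk_end (walk_end v w1) w2 = walk_end v w1.
  by rewrite -walk_end_cat -Ew12; apply: esym f0.
move: wP; rewrite Ew is_walk_cat is_walk_cat -cats1 is_walk_cat w2u /=.
case/andP=> /and3P[w1P w2P /andP[/eqP ku _]] w3P.
have w2kP : is_walk (walk_end v w1) (rcons w2 k).
  by rewrite -cats1 is_walk_cat w2P w2u /= ku eqxx.
have w12P : is_walk v (w1 ++ rcons w2 k) by rewrite is_walk_cat w1P.
have Eend : walk_end (walk_end v w1) (rcons w2 k) = tgt k.
  by rewrite /walk_end map_rcons last_rcons.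
rewrite cats1 in w3P.
exists k, (@QPath Q (v, w1) w1P), (@QPath Q (walk_end v w1, rcons w2 k) w2kP).
exists (@QPath Q (walk_end v (w1 ++ rcons w2 k), w3) w3P); split => //.
  rewrite /plength /pword /= size_rcons size_take size_drop.
  by case: ifP; lia.
rewrite (pelt_mulE (r := @QPath Q (v, w1 ++ rcons w2 k) w12P)) //.
apply/esym/pelt_mulE => //; rewrite /pstart /pword /= -Ew.
by rewrite /w /v /pword /pstart -surjective_pairing.
Qed.

(** A path beyond the bound contains a subpath [p2] parallel to an arrow and longer than [m]; that
    subpath already lies in the ideal. *)
Lemma parallel_paths_nilpotent (S : KQ -> Prop) (d m : nat) :
  (forall s, S s -> homog path_basis d s) ->
  (forall k (p : qpath Q), pstart p = src k -> pend p = tgt k ->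
     exists2 y, (forall e, (m < e)%N -> part path_basis e y = 0) &
       ideal_gen S (pelt K p - y)) ->
  forall x, deg_ge path_basis (#|vertex Q| * m.+1).+1 x -> ideal_gen S x.
Proof.
move=> Shom par x; elim=> {x} [|x y _ Ix _ Iy|c x _ Ix|p /= mp].
- exact: ideal_gen0.
- exact: ideal_genD Ix Iy.
- exact: (@ideal_genZ K (path_alg K Q)) Ix.
have [k [p1 [p2 [p3 [sk tk mp2 ->]]]]] := long_path_parallel mp.
apply/ideal_genMr/ideal_genMl.
have [y y0 Iy] := par k p2 sk tk.
(* In degree [plength p2], above [m], the element [y] has no component, so the component of
   [pelt K p2 - y] is the path itself. *)
have := homogeneous_ideal_part Shom (plength p2) Iy.
rewrite partB y0 // subr0.
have /(_ (plength p2)) := @homog_elt _ _ path_basis p2.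
by rewrite eqxx => ->.
Qed.

End PathAlgebraGrading.

(** * The deformation term and the relations of type E *)

Lemma deg_ge_eval2 (K : comNzRingType) (A : algType K) (B : length_basis A)
    (e u v : A) (F : free_alg K 'I_2) (d m : nat) :
  deg_ge B d u -> deg_ge B d v ->
  (forall w, w \in msupp F -> (m <= fdeg w)%N) ->
  deg_ge B (d * m) (eval2 e u v F).
Proof.
move=> du dv mF; rewrite /eval2 big_seq_cond; apply: deg_ge_sum => w.
rewrite andbT => /mF mw; apply: deg_geZ.
apply: (@deg_geW _ _ _ _ (0 + d * size (w : seq 'I_2))).
  by rewrite add0n leq_mul2l -fdegE mw orbT.
apply: deg_geM; first exact: deg_ge_all.
by apply: deg_ge_prod => i; case: ifP.
Qed.

(** The deformation changes a single entry in the list of relations; [y + 0] is the form that this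
    entry takes in [Erels 0]. *)
Lemma mem_perturb (V : zmodType) (s t : seq V) (y g z : V) :
  z \in s ++ (y + 0) :: t ->
  z \in s ++ (y + g) :: t \/ z + g \in s ++ (y + g) :: t.
Proof.
rewrite !mem_cat !in_cons addr0 => /or3P[->|/eqP->|->]; first by left.
- by right; rewrite eqxx orbT.
- by left; rewrite !orbT.
Qed.

Section Relations.
Variables (K : comNzRingType) (n : dynkinE).
Local Notation KQ := (path_alg K (EQ n)).
Local Notation B := (path_basis K (EQ n)).

Lemma Erels_perturb (g z : KQ) :
  z \in Erels 0 -> z \in Erels g \/ z + g \in Erels g.
(* Three relations precede the deformed one at the vertex 3. *)
Proof. exact: (@mem_perturb _ [:: _; _; _]). Qed.

Lemma homog_arrowM (k l : arrow (EQ n)) :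
  homog B 2 (pa_arrow K k * pa_arrow K l).
Proof. exact: homogM (homog_arrow K k) (homog_arrow K l). Qed.

Lemma Erels_homog (z : KQ) : P_rel z -> homog B 2 z.
Proof.
have arrM := homog_arrowM; rewrite /P_rel /Erels !mem_cat => /or3P[||].
- rewrite !inE => /or4P[] /eqP->.
  + exact: arrM.
  + exact: arrM.
  + exact: homogD (arrM _ _) (arrM _ _).
  + apply: homogD (homog0 _ _).
    exact: homogD (homogD (arrM _ _) (arrM _ _)) (arrM _ _).
- by case/mapP => i _ ->; exact: homogD (arrM _ _) (arrM _ _).
- by rewrite inE => /eqP->; exact: arrM.
Qed.

Lemma P_pathE (w : seq (arrow (EQ n))) :
  P_path K w = qproj (@P_rel_proper K n) (\prod_(a <- w) pa_arrow K a).
Proof. by rewrite rmorph_prod. Qed.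

(** The prefix of length exactly [(maxlen n).+1] of a long path is one of the defining relations. *)
Lemma Pf_rel_nilpotent (F : free_alg K 'I_2) (x : KQ) :
  deg_ge B (maxlen n).+1 x -> ideal_gen (Pf_rel F) x.
Proof.
elim=> {x} [|x y _ Ix _ Iy|c x _ Ix|p /= mp].
- exact: ideal_gen0.
- exact: ideal_genD Ix Iy.
- exact: (@ideal_genZ K (path_alg K (EQ n))) Ix.
have [p1 [p2 [lp1 ->]]] := path_split K mp.
by apply/ideal_genMr/ideal_gen_in; right; exists p1.
Qed.

End Relations.

Theorem theorem2p1 (n : dynkinE) (K : closedFieldType)
    (f : R_E K n) (f_admissible : admissible f)
    (F : free_alg K 'I_2)
    (F_degree : forall w, w \in msupp F -> (2 <= fdeg w)%N)
    (F_class : R_class n F = f)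
    (cnt : arrow (EQ n) -> nat -> nat)
    (pth : forall (k : arrow (EQ n)) (l : nat),
       'I_(cnt k l) -> l.-tuple (arrow (EQ n)))
    (pth_path : forall k l (j : 'I_(cnt k l)), (2 <= l <= maxlen n)%N ->
       is_walk (src k) (pth k l j) /\ walk_end (src k) (pth k l j) = tgt k)
    (pth_basis : forall k,
       is_basis (corner (P_vertex K (src k)) (P_vertex K (tgt k)))
         (P_arrow K k ::
          [seq P_path K (pth k l j)
             | l <- index_iota 2 (maxlen n).+1, j <- enum 'I_(cnt k l)]))
    (phi : {lrmorphism Pf_E n F -> P_E K n})
    (phi_vertex : forall v, phi (Pf_vertex F v) = P_vertex K v)
    (alpha : forall (k : arrow (EQ n)) (l : nat), 'I_(cnt k l) -> K)
    (phi_arrow : forall k,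
       phi (Pf_arrow F k) =
         P_arrow K k
         + \sum_(2 <= l < (maxlen n).+1) \sum_(j < cnt k l)
             alpha k l j *: P_path K (pth k l j)) :
  exists psi : {lrmorphism P_E K n -> Pf_E n F},
    cancel phi psi /\ cancel psi phi.
Proof.
pose pi : {lrmorphism path_alg K (EQ n) -> P_E K n} :=
  qproj (@P_rel_proper K n).
pose B := path_basis K (EQ n).
have elt_prod (p : qpath (EQ n)) : exists v w,
    size w = plength p /\
    pelt K p = pa_vertex K v * \prod_(a <- w) pa_arrow K a.
  by exists (pstart p), (pword p); split=> //; apply: pelt_prod.
have rels z : P_rel z -> exists2 g, deg_ge B 3 g & ideal_gen (Pf_rel F) (z + g).
  pose ar i := pa_arrow K (inord i : arrow (EQ n)).
  pose g0 := eval2 (pa_vertex K (inord 3 : vertex (EQ n)))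
    (ar (n + 0 - 1)%N * ar 0%N) (ar (n + 2 - 1)%N * ar 2%N) F.
  case/(Erels_perturb g0) => [zg|zg].
    by exists 0; [apply: deg_ge0 | rewrite addr0; apply: ideal_gen_in; left].
  exists g0; last by apply: ideal_gen_in; left.
  (* Monomials of [F] have at least 2 factors, each evaluated at a product of two arrows, so the
     deformation term starts in degree 4. *)
  apply: (@deg_geW _ _ _ _ (2 * 2)) => //.
  by apply: deg_ge_eval2 F_degree; apply: (deg_geM (d := 1) (e := 1));
    apply: deg_ge_arrow.
have arr k : exists2 h, deg_ge B 2 h &
    phi (Pf_arrow F k) = pi (pa_arrow K k + h).
  exists (\sum_(2 <= l < (maxlen n).+1) \sum_(j < cnt k l)
      alpha k l j *: \prod_(a <- pth k l j) pa_arrow K a).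
    rewrite big_nat; apply: deg_ge_sum => l /andP[l2 _].
    apply: deg_ge_sum => j _; apply/deg_geZ/(deg_geW l2).
    have := deg_ge_prod (pth k l j) (@deg_ge_arrow K (EQ n)).
    by rewrite mul1n size_tuple.
  rewrite phi_arrow raddfD /=; congr (_ + _).
  rewrite raddf_sum; apply: eq_bigr => l _.
  rewrite raddf_sum; apply: eq_bigr => j _.
  by rewrite P_pathE; exact: esym (linearZ_LR pi _ _).
have par k (p : qpath (EQ n)) : pstart p = src k -> pend p = tgt k ->
    exists2 y, (forall e, (maxlen n < e)%N -> part B e y = 0) &
      ideal_gen (@P_rel K n) (pelt K p - y).
  (* [L] is the subspace of classes having a representative without components above degree
     [maxlen n]; the given basis lies in it, hence so does its span. *)
  move=> sp tp; pose L u := exists2 y,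
    (forall e, (maxlen n < e)%N -> part B e y = 0) & u = pi y.
  have homogL d y : (d <= maxlen n)%N -> homog B d y -> L (pi y).
    move=> dm Hy; exists y => // e me.
    by rewrite Hy gtn_eqF // (leq_ltn_trans dm).
  suff [y Hy Ey] : L (pi (pelt K p))
    by exists y => //; apply/(qproj_eq (@P_rel_proper K n)).
  have [_ _ span] := pth_basis k.
  have /span [c ->] : corner (P_vertex K (src k)) (P_vertex K (tgt k))
      (pi (pelt K p)).
    have Ep : pelt K p = pa_vertex K (src k) * pelt K p * pa_vertex K (tgt k).
      by rewrite -sp -tp; apply: pelt_corner.
    exists (pi (pelt K p)); rewrite [in LHS]Ep.
    exact: etrans (rmorphM pi _ _) (congr1 (fun z => z * _) (rmorphM pi _ _)).
  apply: big_ind => [|_ _ [y Hy ->] [z Hz ->]|i _].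
  - by exists 0 => [e _|]; [apply: part0 | rewrite raddf0].
  - exists (y + z) => [e me|]; first by rewrite partD Hy // Hz // addr0.
    by rewrite -raddfD.
  suff [y Hy ->] : L (P_arrow K k :: [seq P_path K (pth k l j)
      | l <- index_iota 2 (maxlen n).+1, j <- enum 'I_(cnt k l)])`_i.
    exists (c i *: y) => [e me|]; first by rewrite partZ Hy // scaler0.
    exact: esym (linearZ_LR pi _ _).
  (* A basis element is the arrow, of degree 1, or a chosen path of length [l] at most [maxlen n];
     both have homogeneous lifts. *)
  have /predU1P[->|/allpairsPdep[l [j [+ _ ->]]]] := mem_nth 0 (ltn_ord i).
    by apply: (homogL 1) (homog_arrow K k); case: (n).
  rewrite mem_index_iota P_pathE => /andP[_ lm].
  by apply: homogL (homog_arrow_prod K _); rewrite size_tuple.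
have nilp := parallel_paths_nilpotent (@Erels_homog K n) par.
apply: bijective_lrmorphism_inverse.
- exact: (phi_injective (B := B) elt_prod (@deg_ge_arrow K (EQ n))
    (@Erels_homog K n) rels (@Pf_rel_nilpotent K n F) phi_vertex arr).
- exact: (phi_surjective (B := B) elt_prod (@deg_ge_arrow K (EQ n)) nilp
    phi_vertex arr).
Qed.
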